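(* Let $\mathcal N$ be a finite abelian network with total alphabet $A$, and let $\mathbf x.\mathbf q$ be a configuration of $\mathcal N$. Then for any $\mathbf n\in\mathbb N^A$ and any legal execution $w$ for $\mathbf x.\mathbf q$, the word $w\setminus\mathbf n$ is a legal execution for $\pi_{\mathbf n}(\mathbf x.\mathbf q)$.
   Context: Abelian networks. $\mathbb N=\{0,1,2,\dots\}$. Let $G=(V,E)$ be a finite directed graph (self-loops and multiple edges allowed). An abelian network $\mathcal N$ on $G$ assigns to each $v\in V$ a nonempty input alphabet $A_v$ and a nonempty state space $Q_v$ (the $A_v$ pairwise disjoint), maps $T_a:Q_v\to Q_v$ for $a\in A_v$, and, for each edge $e$ from $v$ to $u$, a message-passing function $T_e:Q_v\times A_v\to A_u^*$ (free monoid of words), such that for all $v$, $a,b\in A_v$, $q\in Q_v$: $T_aT_b=T_bT_a$, and for every edge $e$ out of $v$ the words $T_e(q,a)T_e(T_a(q),b)$ and $T_e(q,b)T_e(T_b(q),a)$ agree up to permuting letters. Put $A=\bigsqcup_v A_v$, $Q=\prod_v Q_v$; $\mathcal N$ is finite if $A$ and $Q$ are finite. For a word $w\in A^*$, $|w|\in\mathbb N^A$ counts the occurrences of each letter. For $a\in A_v$, $\mathbf q\in Q$: $t_a\mathbf q$ is $\mathbf q$ with $\mathbf q(v)$ replaced by $T_a(\mathbf q(v))$, and $\mathbf M_a(\mathbf q)=\sum_{e\text{ out of }v}|T_e(\mathbf q(v),a)|\in\mathbb N^A$. A configuration is a pair $\mathbf x.\mathbf q$ with $\mathbf x\in\mathbb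 Z^A$, $\mathbf q\in Q$; $\pi_a(\mathbf x.\mathbf q)=(\mathbf x+\mathbf M_a(\mathbf q)-|a|).t_a\mathbf q$. For a word $w=a_1\cdots a_\ell$, $\pi_w=\pi_{a_\ell}\cdots\pi_{a_1}$; this depends only on $|w|$, so $\pi_{\mathbf n}$ is defined for $\mathbf n\in\mathbb N^A$ as $\pi_w$ for any $w$ with $|w|=\mathbf n$. The word $w=a_1\cdots a_\ell$ is a legal execution for $\mathbf x.\mathbf q$ if, with $\mathbf x_i.\mathbf q_i=\pi_{a_1\cdots a_i}(\mathbf x.\mathbf q)$, $\mathbf x_{i-1}(a_i)\ge1$ for all $1\le i\le\ell$. Removal. For $w\in A^*$ and $\mathbf n\in\mathbb N^A$, $w\setminus\mathbf n$ is the word obtained from $w$ by deleting the first $\mathbf n(a)$ occurrences of $a$ for every $a\in A$ (all occurrences of $a$ if there are fewer than $\mathbf n(a)$). *)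

(* Defs.v *)
From mathcomp Require Import all_boot all_order all_algebra.

Set Implicit Arguments.
Unset Strict Implicit.
Unset Printing Implicit Defensive.

Import Order.TTheory GRing.Theory Num.Theory.
Local Open Scope ring_scope.

(* [edge v u] is the finite set of edges from v to u, so that self-loops and
   multiple edges are allowed. *)
Record digraph := Digraph {
  vertex : finType;
  edge : vertex -> vertex -> finType
}.

(* Finite abelian networks only: since there are finitely many vertices and the
   alphabets and state spaces are nonempty, the disjoint union A and the product
   Q are finite exactly when every [alph v] and every [state v] is. *)
Record finite_abelian_network (G : digraph) := FiniteAbelianNetwork {
  alph : vertex G -> finType;
  state : vertex G -> finType;
  alph_nonempty : forall v, (0 < #|alph v|)%N;
  state_nonempty : forall v, (0 < #|state v|)%N;
  trans : forall v, alph v -> state v -> state v;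
  message : forall v u, edge v u -> state v -> alph v -> seq (alph u);
  transC : forall v (a b : alph v) (q : state v),
    trans a (trans b q) = trans b (trans a q);
  messageC : forall v u (e : edge v u) (a b : alph v) (q : state v),
    perm_eq (message e q a ++ message e (trans a q) b)
            (message e q b ++ message e (trans b q) a)
}.

Section Network.

Variables (G : digraph) (N : finite_abelian_network G).

(* The dependent sum makes the alphabets of distinct vertices disjoint. *)
Definition letter : finType := {v : vertex G & alph N v}.

Definition letter_of v (a : alph N v) : letter := Tagged (fun v => alph N v) a.

Definition word := seq letter.

Definition letter_vec := {ffun letter -> nat}.

Definition total_state := {dffun forall v : vertex G, state N v}.

Definition config := ({ffun letter -> int} * total_state)%type.

Definition word_count (w : word) : letter_vec := [ffun a => count_mem a w].

Definition update (a : letter) (q : total_state) : total_state :=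
  [ffun u => dfwith q (trans (tagged a) (q (tag a))) u].

Definition messages (a : letter) (q : total_state) : letter_vec :=
  [ffun b => \sum_(u : vertex G) \sum_(e : edge (tag a) u)
     word_count (map (@letter_of u) (message e (q (tag a)) (tagged a))) b]%N.

Definition exec_letter (c : config) (a : letter) : config :=
  ([ffun b => c.1 b + (messages a c.2 b)%:Z - (b == a)%:Z], update a c.2).

Definition exec (c : config) (w : word) : config := foldl exec_letter c w.

Definition word_of_vec (n : letter_vec) : word :=
  flatten [seq nseq (n a) a | a <- enum letter].

(* pi_n is computed along one fixed word with letter counts n; by [exec_vecE]
   below every such word gives the same configuration. *)
Definition exec_vec (n : letter_vec) (c : config) : config :=
  exec c (word_of_vec n).

(* Positions are numbered from 0: at position i the letters of [take i w] have
   already been processed. *)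
Definition legal (c : config) (w : word) : Prop :=
  forall i : 'I_(size w),
    1 <= (exec c (take i w)).1 (tnth (in_tuple w) i).

Fixpoint removal (w : word) (n : letter_vec) : word :=
  if w is a :: w' then
    if (0 < n a)%N then removal w' [ffun b => (n b - (b == a))%N]
    else a :: removal w' n
  else [::].

Lemma word_of_vecK n : word_count (word_of_vec n) = n.
Proof.
apply/ffunP=> a; rewrite ffunE count_flatten -map_comp sumnE big_map.
rewrite (eq_bigr (fun b => if b == a then n b else 0)%N); last first.
  by move=> b _ /=; rewrite count_nseq /=; case: (b == a); rewrite ?mul1n ?mul0n.
by rewrite big_enum /= -big_mkcond big_pred1_eq.
Qed.

Lemma updateE a (q : total_state) u :
  update a q u = dfwith q (trans (tagged a) (q (tag a))) u.
Proof. exact: ffunE. Qed.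

Lemma update_neq a (q : total_state) u : tag a != u -> update a q u = q u.
Proof. by move=> neq_au; rewrite updateE dfwith_out. Qed.

Lemma update_eq v (a : alph N v) (q : total_state) :
  update (letter_of a) q v = trans a (q v).
Proof. by rewrite updateE dfwith_in. Qed.

Lemma updateC a b q : update a (update b q) = update b (update a q).
Proof.
case: a b => [v a] [u b]; apply/ffunP=> s.
have [eq_vu|neq_vu] := eqVneq v u.
  case: u / eq_vu b => b; have [<-|neq_vs] := eqVneq v s.
    by rewrite !update_eq transC.
  by rewrite !update_neq.
have [<-|neq_vs] := eqVneq v s.
  rewrite update_eq [RHS]update_neq 1?eq_sym // update_eq.
  by rewrite update_neq 1?eq_sym.
have [<-|neq_us] := eqVneq u s.
  by rewrite update_neq // !update_eq update_neq.
by rewrite !update_neq.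
Qed.

Lemma messagesE v (a : alph N v) q d :
  messages (letter_of a) q d =
  (\sum_(u : vertex G) \sum_(e : edge v u)
     count_mem d (map (@letter_of u) (message e (q v) a)))%N.
Proof.
rewrite ffunE; apply: eq_bigr => u _; apply: eq_bigr => e _.
by rewrite ffunE.
Qed.

Lemma messagesC a b q (d : letter) :
  (messages a q d + messages b (update a q) d =
   messages b q d + messages a (update b q) d)%N.
Proof.
case: a b => [v a] [u b]; rewrite -!/(letter_of _).
have [eq_vu|neq_vu] := eqVneq v u.
  case: u / eq_vu b => b; rewrite !messagesE -!big_split /=.
  apply: eq_bigr => s _; rewrite -!big_split /=; apply: eq_bigr => e _.
  rewrite !update_eq -!count_cat -!map_cat.
  by apply/permP/perm_map/messageC.
rewrite [LHS]addnC; congr addn; rewrite !messagesE.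
  by apply: eq_bigr => s _; apply: eq_bigr => e _; rewrite update_neq.
by apply: eq_bigr => s _; apply: eq_bigr => e _; rewrite update_neq // eq_sym.
Qed.

Lemma exec_letterC c a b :
  exec_letter (exec_letter c a) b = exec_letter (exec_letter c b) a.
Proof.
congr pair; last exact: updateC.
apply/ffunP=> d; rewrite [LHS]ffunE [RHS]ffunE /=.
rewrite [in LHS]ffunE [in RHS]ffunE.
have := congr1 Posz (messagesC a b c.2 d); rewrite !PoszD.
set m1 := Posz _; set m2 := Posz _; set m3 := Posz _; set m4 := Posz _ => eqM.
have -> : c.1 d + m1 - (d == a)%:Z + m2 - (d == b)%:Z =
          c.1 d + (m1 + m2) - ((d == a)%:Z + (d == b)%:Z).
  by rewrite opprD !addrA [_ - _ + m2]addrAC.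
have -> : c.1 d + m3 - (d == b)%:Z + m4 - (d == a)%:Z =
          c.1 d + (m3 + m4) - ((d == a)%:Z + (d == b)%:Z).
  by rewrite opprD !addrA [_ - _ + m4]addrAC [RHS]addrAC.
by rewrite eqM.
Qed.

Lemma exec_perm c w1 w2 : perm_eq w1 w2 -> exec c w1 = exec c w2.
Proof.
have exec_cons a c' w : exec c' (a :: w) = exec (exec_letter c' a) w by [].
have execC c' a w : exec (exec_letter c' a) w = exec_letter (exec c' w) a.
  by elim: w c' => // b w IHw c'; rewrite !exec_cons exec_letterC IHw.
elim: w1 w2 c => [|a w1 IHw] w2 c eq_w12.
  by rewrite perm_sym in eq_w12; rewrite (perm_nilP eq_w12).
have w2a : a \in w2 by rewrite -(perm_mem eq_w12) mem_head.
case/splitPr: w2 / w2a eq_w12 => u v eq_w12.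
have {}eq_w12 : perm_eq w1 (u ++ v).
  by rewrite -(perm_cons a) (perm_trans eq_w12) // -cat1s perm_catCA.
by rewrite exec_cons (IHw _ _ eq_w12) /exec !foldl_cat -!/(exec _ _) execC.
Qed.

Lemma exec_vecE c w : exec_vec (word_count w) c = exec c w.
Proof.
apply/exec_perm/allP=> a _ /=.
by have /ffunP/(_ a) := word_of_vecK (word_count w); rewrite !ffunE => ->.
Qed.

End Network.

(* Main.v *)
(* Induction on [w = a :: w']. If [n a > 0], one [a] is moved to the front of
   the execution of [n], and [w'] is legal after [a]. If [n a = 0], executing [n]
   never consumes an [a], so it cannot lower the positive count of [a], and [a]
   is still legal after [n]; moreover executing [n] and then [a] amounts to
   executing [a] and then [n]. *)
Require Import Defs.
From mathcomp Require Import all_boot all_order all_algebra.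

Set Implicit Arguments.
Unset Strict Implicit.
Unset Printing Implicit Defensive.

Import Order.TTheory GRing.Theory Num.Theory.
Local Open Scope ring_scope.

Section Removal.

Variables (G : digraph) (N : finite_abelian_network G).
Implicit Types (c : config N) (a : letter N) (w : word N) (n : letter_vec N).

(** Turns the positionwise definition of [legal] into a recursion on the word, as the induction
    needs. *)
Lemma legal_cons c a w :
  legal c (a :: w) <-> 1 <= c.1 a /\ legal (exec_letter c a) w.
Proof.
split=> [legal_aw | [c_a legal_w] i].
  split=> [|i]; first exact: (legal_aw ord0).
  by have := legal_aw (lift ord0 i); rewrite !(tnth_nth a).
by case: i => [[|i] lt_i]; rewrite (tnth_nth a) //=;
   have := legal_w (Ordinal (lt_i : (i < size w)%N)); rewrite (tnth_nth a).
Qed.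

Lemma exec_letter_exec c w a :
  exec_letter (exec c w) a = exec (exec_letter c a) w.
Proof.
rewrite -[LHS](foldl_rcons (@exec_letter G N)).
by apply: (@exec_perm G N c (rcons w a) (a :: w)); rewrite perm_rcons.
Qed.

Lemma count_word_of_vec n a : count_mem a (word_of_vec n) = n a.
Proof. by rewrite -[in RHS](word_of_vecK n) ffunE. Qed.

(** Both sides execute words with equal letter counts: [0 < n a] makes the truncated subtraction
    exact. *)
Lemma exec_vec_cons c n a : (0 < n a)%N ->
  exec_vec n c =
  exec_vec [ffun b => (n b - (b == a))%N] (exec_letter c a).
Proof.
move=> n_a; apply: (@exec_perm G N c _ (a :: word_of_vec _)).
apply/allP => b _ /=; rewrite !count_word_of_vec ffunE [a == b]eq_sym.
by case: (eqVneq b a) => [->|_] /=; rewrite ?subn0 // add1n subn1 prednK.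
Qed.

(** Only executing [a] itself consumes an [a]; the messages sent by other letters can only add to
    its count. *)
Lemma exec_count_le c w a : a \notin w -> c.1 a <= (exec c w).1 a.
Proof.
elim: w c => //= b w IHw c; rewrite inE negb_or => /andP[neq_ab w'a].
apply: le_trans (IHw (exec_letter c b) w'a).
by rewrite ffunE (negPf neq_ab) subr0 lerDl.
Qed.

Lemma legal_removal c n w : legal c w -> legal (exec_vec n c) (removal w n).
Proof.
elim: w c n => [|a w IHw] c n; first by move=> _ [].
case/legal_cons=> c_a legal_w /=; case: posnP => [n_a0|n_a]; last first.
  by rewrite (exec_vec_cons c n_a); apply: IHw.
apply/legal_cons; split; last by rewrite exec_letter_exec; apply: IHw.
apply: le_trans c_a (exec_count_le c _).
(* Since [n a = 0], the word executed for [n] has no [a]. *)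
by apply/count_memPn; rewrite count_word_of_vec.
Qed.

End Removal.

Theorem lemma4p2 (G : digraph) (N : finite_abelian_network G) (c : config N)
    (n : letter_vec N) (w : word N) :
  legal c w -> legal (exec_vec n c) (removal w n).
Proof. exact: legal_removal. Qed.
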